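(* Let $x$ be a semi-discrete maximal surface in $\mathbb{R}^{2,1}$ determined by a semi-discrete holomorphic function $g$. (i) At any singular point $x(k,t)$ with respect to the discrete direction such that the principal curvatures $\kappa_{k-1,k}(t)$ and $\kappa_{k,k+1}(t)$ are both finite, at least one of the two adjacent edges $[x(k-1,t),x(k,t)]$, $[x(k,t),x(k+1,t)]$ is singular. (ii) At any singular point $x(k,t)$ with respect to the smooth direction, the only possibility is that $\kappa=\kappa_k(t)$ is infinite there and the corresponding image $g(k,t)$ of $g$ lies in $\mathbb{S}^1=\{z\in\mathbb{C}:|z|=1\}$ there.
   Context: Semi-discrete maps are maps $y(k,t)$ on a subdomain of $\mathbb{Z}\times\mathbb{R}$; write $y=y(k,t)$, $y_1=y(k+1,t)$, $\partial y=\frac{dy}{dt}$, $\Delta y=y_1-y$. $\mathbb{R}^{2,1}$ is $3$-dimensional Minkowski space, with metric of signature $(+,+,-)$. A semi-discrete holomorphic function is a map $g(k,t)\in\mathbb{C}$ with $\partial g$ and $\Delta g$ never zero and $\dfrac{\partial g\,\partial g_1}{(\Delta g)^2}=\dfrac{\tau(t)}{\sigma(k)}<0$ for a real-valued function $\tau$ of $t$ only and a real-valued function $\sigma$ of $k$ only. The semi-discrete maximal surface determined by $g$ is a solution $x$ of $$\partial x=\mathrm{Re}\left(\frac{\tau}{2\partial g}\begin{pmatrix}1+g^2\\ i(1-g^2)\\ -2g\end{pmatrix}\right),\qquad \Delta x=\mathrm{Re}\left(\frac{\sigma}{2\Delta g}\begin{pmatrix}1+gg_1\\ i(1-gg_1)\\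 -(g+g_1)\end{pmatrix}\right),$$ with normal field $n=\dfrac{1}{1-|g|^2}\begin{pmatrix}-2\,\mathrm{Re}(g)\\-2\,\mathrm{Im}(g)\\1+|g|^2\end{pmatrix}$. Principal curvatures: $\kappa_k(t)$ and $\kappa_{k,k+1}(t)$ are the scalars with $\partial n=-\kappa_k(t)\,\partial x$ at $(k,t)$ and $\Delta n=-\kappa_{k,k+1}(t)\,\Delta x$ at the edge joining $(k,t)$ and $(k+1,t)$. For the surface $x$ they are $\kappa_k(t)=\dfrac{-4|\partial g|^2}{\tau(1-|g|^2)^2}$ and $\kappa_{k,k+1}(t)=\dfrac{-4|\Delta g|^2}{\sigma(1-|g|^2)(1-|g_1|^2)}$, and they are infinite where the denominators vanish. A point $x(k,t)$ is singular with respect to the discrete direction if $\kappa_{k-1,k}(t)\kappa_{k,k+1}(t)<0$ or at least one of these two is infinite. It is singular with respect to the smooth direction if $\kappa_{k-1}(t)\kappa_k(t)<0$, or $\kappa_k(t)\kappa_{k+1}(t)<0$, or at least one of $\kappa_{k-1}(t),\kappa_k(t),\kappa_{k+1}(t)$ is infinite. The tangent plane at the edge $[x,x_1]$ is the plane containing $\partial x,\partial x_1,\Delta x$ (these are coplanar). The edge $[x,x_1]$ is singular if this tangent plane is not spacelike.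
   Formalization: In (ii), since a point also counts as singular when a neighbouring curvature is infinite, the claim proved is: no sign change occurs, some κ_j(t) with j in {k-1,k,k+1} is infinite, and g(j,t) lies in S^1 for every such j; κ_k(t) itself need not be infinite. *)

(* Defs.v *)
From Stdlib Require Import Reals ZArith.
From Coquelicot Require Import Coquelicot.
Open Scope R_scope.

(** [R^{2,1}]: the vector space [R * R * R] (with the Coquelicot module
    operations [plus], [minus], [scal], [zero]) and the form of signature
    [(+,+,-)]. *)
Definition R21 : Type := (R * R * R)%type.

Definition mk21 (a b c : R) : R21 := (a, b, c).

Definition minkowski (u v : R21) : R :=
  fst (fst u) * fst (fst v) + snd (fst u) * snd (fst v) - snd u * snd v.

Definition lin_indep (u v : R21) : Prop :=
  forall a b : R, plus (scal a u) (scal b v) = zero -> a = 0 /\ b = 0.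

Definition is_plane (P : R21 -> Prop) : Prop :=
  exists u v : R21, lin_indep u v /\
    forall w : R21, P w <-> exists a b : R, w = plus (scal a u) (scal b v).

Definition spacelike (P : R21 -> Prop) : Prop :=
  forall v : R21, P v -> v <> zero -> 0 < minkowski v v.

(** Semi-discrete maps are encoded as total functions [Z -> R -> _] together
    with a domain [D]; values outside [D] are never constrained.  A subdomain
    of [Z * R] is only required to be open (in the [t]-direction). *)
Definition is_subdomain (D : Z -> R -> Prop) : Prop :=
  forall (k : Z) (t : R), D k t -> locally t (D k).

Definition dC (y : R -> C) (t : R) : C :=
  (Derive (fun s => Re (y s)) t, Derive (fun s => Im (y s)) t).

Definition differentiableC (y : R -> C) (t : R) : Prop :=
  ex_derive (fun s => Re (y s)) t /\ ex_derive (fun s => Im (y s)) t.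

Definition dV (y : R -> R21) (t : R) : R21 :=
  mk21 (Derive (fun s => fst (fst (y s))) t)
       (Derive (fun s => snd (fst (y s))) t)
       (Derive (fun s => snd (y s)) t).

Definition differentiableV (y : R -> R21) (t : R) : Prop :=
  ex_derive (fun s => fst (fst (y s))) t /\
  ex_derive (fun s => snd (fst (y s))) t /\
  ex_derive (fun s => snd (y s)) t.

Definition DeltaC (y : Z -> R -> C) (k : Z) (t : R) : C :=
  (y (k + 1)%Z t - y k t)%C.

Definition DeltaV (y : Z -> R -> R21) (k : Z) (t : R) : R21 :=
  minus (y (k + 1)%Z t) (y k t).

(** [sigma k] belongs to the edge joining [k] and [k + 1]. *)
Definition sd_holomorphic (D : Z -> R -> Prop) (g : Z -> R -> C)
    (tau : R -> R) (sigma : Z -> R) : Prop :=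
  (forall k t, D k t -> differentiableC (g k) t /\ dC (g k) t <> RtoC 0) /\
  (forall k t, D k t -> D (k + 1)%Z t ->
     DeltaC g k t <> RtoC 0 /\
     sigma k <> 0 /\
     (dC (g k) t * dC (g (k + 1)%Z) t / (DeltaC g k t * DeltaC g k t))%C
       = RtoC (tau t / sigma k) /\
     tau t / sigma k < 0).

Definition Re3 (a b c : C) : R21 := mk21 (Re a) (Re b) (Re c).

Definition sd_maximal (D : Z -> R -> Prop) (g : Z -> R -> C)
    (tau : R -> R) (sigma : Z -> R) (x : Z -> R -> R21) : Prop :=
  (forall k t, D k t ->
     differentiableV (x k) t /\
     let z := g k t in
     let w := (RtoC (tau t) / (RtoC 2 * dC (g k) t))%C in
     dV (x k) t =
       Re3 (w * (RtoC 1 + z * z))%C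
           (w * (Ci * (RtoC 1 - z * z)))%C
           (w * (- (RtoC 2 * z)))%C) /\
  (forall k t, D k t -> D (k + 1)%Z t ->
     let z := g k t in
     let z1 := g (k + 1)%Z t in
     let w := (RtoC (sigma k) / (RtoC 2 * DeltaC g k t))%C in
     DeltaV x k t =
       Re3 (w * (RtoC 1 + z * z1))%C
           (w * (Ci * (RtoC 1 - z * z1)))%C
           (w * (- (z + z1)))%C).

(** Meaningful only where [Cmod (g k t) <> 1]. *)
Definition normal (g : Z -> R -> C) (k : Z) (t : R) : R21 :=
  let z := g k t in
  scal (/ (1 - Cmod z ^ 2)) (mk21 (- 2 * Re z) (- 2 * Im z) (1 + Cmod z ^ 2)).

(** Up to a common sign (depending on the orientation of [normal]) the
    principal curvatures are [4|dg|^2 / (tau (1-|g|^2)^2)] and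
    [4|Delta g|^2 / (sigma (1-|g|^2)(1-|g_1|^2))].  A curvature is infinite
    where the denominator of this expression vanishes; elsewhere it is the
    scalar of the equation [dn = - kappa dx], resp.
    [Delta n = - kappa Delta x]. *)
Definition curv_den (g : Z -> R -> C) (tau : R -> R) (k : Z) (t : R) : R :=
  tau t * (1 - Cmod (g k t) ^ 2) ^ 2.

Definition edge_curv_den (g : Z -> R -> C) (sigma : Z -> R) (k : Z) (t : R)
    : R :=
  sigma k * (1 - Cmod (g k t) ^ 2) * (1 - Cmod (g (k + 1)%Z t) ^ 2).

Definition curv_infinite (g : Z -> R -> C) (tau : R -> R) (k : Z) (t : R)
    : Prop :=
  curv_den g tau k t = 0.

Definition edge_curv_infinite (g : Z -> R -> C) (sigma : Z -> R)
    (k : Z) (t : R) : Prop :=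
  edge_curv_den g sigma k t = 0.

Definition is_curv (g : Z -> R -> C) (tau : R -> R) (x : Z -> R -> R21)
    (k : Z) (t : R) (kappa : R) : Prop :=
  ~ curv_infinite g tau k t /\
  dV (normal g k) t = scal (- kappa) (dV (x k) t).

(** The curvature [kappa_{k,k+1}(t)] is indexed by the left end [k]. *)
Definition is_edge_curv (g : Z -> R -> C) (sigma : Z -> R)
    (x : Z -> R -> R21) (k : Z) (t : R) (kappa : R) : Prop :=
  ~ edge_curv_infinite g sigma k t /\
  DeltaV (normal g) k t = scal (- kappa) (DeltaV x k t).

(** Opposite signs of the curvatures at the vertices [(k,t)], [(k+1,t)]. *)
Definition curv_sign_change (g : Z -> R -> C) (tau : R -> R)
    (x : Z -> R -> R21) (k : Z) (t : R) : Prop :=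
  exists kappa kappa1 : R,
    is_curv g tau x k t kappa /\ is_curv g tau x (k + 1)%Z t kappa1 /\
    kappa * kappa1 < 0.

(** Opposite signs of the curvatures of the two edges at the vertex [(k,t)]. *)
Definition edge_curv_sign_change (g : Z -> R -> C) (sigma : Z -> R)
    (x : Z -> R -> R21) (k : Z) (t : R) : Prop :=
  exists kappa0 kappa : R,
    is_edge_curv g sigma x (k - 1)%Z t kappa0 /\
    is_edge_curv g sigma x k t kappa /\
    kappa0 * kappa < 0.

Definition singular_discrete (g : Z -> R -> C) (sigma : Z -> R)
    (x : Z -> R -> R21) (k : Z) (t : R) : Prop :=
  edge_curv_sign_change g sigma x k t \/
  edge_curv_infinite g sigma (k - 1)%Z t \/
  edge_curv_infinite g sigma k t.

Definition singular_smooth (g : Z -> R -> C) (tau : R -> R)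
    (x : Z -> R -> R21) (k : Z) (t : R) : Prop :=
  curv_sign_change g tau x (k - 1)%Z t \/
  curv_sign_change g tau x k t \/
  curv_infinite g tau (k - 1)%Z t \/
  curv_infinite g tau k t \/
  curv_infinite g tau (k + 1)%Z t.

(** The tangent plane is recorded by its (linear) direction plane. *)
Definition is_tangent_plane (x : Z -> R -> R21) (k : Z) (t : R)
    (P : R21 -> Prop) : Prop :=
  is_plane P /\
  P (dV (x k) t) /\ P (dV (x (k + 1)%Z) t) /\ P (DeltaV x k t).

(** Existence is part of the definition, so that coplanarity of the three
    vectors is not presupposed; if they span only a line the plane is not
    unique and every plane through that line has to be non-spacelike. *)
Definition edge_singular (x : Z -> R -> R21) (k : Z) (t : R) : Prop :=
  (exists P, is_tangent_plane x k t P) /\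
  (forall P, is_tangent_plane x k t P -> ~ spacelike P).

(* Main.v *)
(** Both curvatures are read off from inner products: [<dn, dx> = - tau] gives
    [kappa * <dx, dx> = tau], and [<Delta n, Delta x> = - sigma] gives
    [kappa * <Delta x, Delta x> = sigma].  As [dx] is never timelike, all smooth
    curvatures at time [t] have the sign of [tau t].  As all [sigma k] have the
    sign opposite to [tau t], a sign change of the discrete curvatures makes
    one of the two adjacent [Delta x] timelike, and no plane through a timelike
    vector is spacelike. *)
Require Import Defs.
From Stdlib Require Import Reals ZArith Lra Lia.
From Coquelicot Require Import Coquelicot.
Open Scope R_scope.

(** * Linear algebra in Minkowski space *)

Lemma Cmod_sqr (z : C) : Cmod z ^ 2 = fst z * fst z + snd z * snd z.
Proof.
  unfold Cmod. rewrite pow2_sqrt; nra.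
Qed.

Lemma norm2_neq_0 (z : C) : z <> RtoC 0 -> fst z * fst z + snd z * snd z <> 0.
Proof.
  intros hz h. apply hz. destruct z as [a b]; simpl in h.
  assert (a = 0) by nra. assert (b = 0) by nra. now subst.
Qed.

Lemma minkowski_scal_l (c : R) (u v : R21) :
  minkowski (scal c u) v = c * minkowski u v.
Proof.
  destruct u as [[u1 u2] u3], v as [[v1 v2] v3].
  unfold minkowski; simpl; unfold scal; simpl; unfold mult; simpl. ring.
Qed.

Lemma lincomb_coord (r s u1 u2 u3 v1 v2 v3 : R) :
  plus (scal r (mk21 u1 u2 u3)) (scal s (mk21 v1 v2 v3)) =
  mk21 (r * u1 + s * v1) (r * u2 + s * v2) (r * u3 + s * v3).
Proof. reflexivity. Qed.

Lemma scal_coord (r a b c : R) :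
  scal r (mk21 a b c) = mk21 (r * a) (r * b) (r * c).
Proof. reflexivity. Qed.

Lemma mk21_eq (a b c a' b' c' : R) :
  mk21 a b c = mk21 a' b' c' <-> a = a' /\ b = b' /\ c = c'.
Proof.
  split; [intros e; injection e; auto | now intros (-> & -> & ->)].
Qed.

Lemma kernel_is_plane (a b c : R) :
  ~ (a = 0 /\ b = 0 /\ c = 0) ->
  is_plane (fun w : R21 => a * fst (fst w) + b * snd (fst w) + c * snd w = 0).
Proof.
  intros hn.
  assert (hc : a <> 0 \/ b <> 0 \/ c <> 0).
  { destruct (Req_dec a 0), (Req_dec b 0), (Req_dec c 0); tauto. }
  (* In each case the basis comes from solving the equation for a coordinate with nonzero
     coefficient, the other two being free parameters. *)
  destruct hc as [h | [h | h]];
    [ exists (mk21 (- b / a) 1 0), (mk21 (- c / a) 0 1)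
    | exists (mk21 1 (- a / b) 0), (mk21 0 (- c / b) 1)
    | exists (mk21 1 0 (- a / c)), (mk21 0 1 (- b / c)) ];
    (split;
      [ intros r s e; rewrite lincomb_coord in e;
        change zero with (mk21 0 0 0) in e; apply mk21_eq in e; lra
      | intros [[w1 w2] w3]; simpl; split;
        [ intros hw
        | intros (r & s & e); rewrite lincomb_coord in e;
          apply mk21_eq in e; destruct e as (-> & -> & ->); field; exact h ] ]).
  - exists w2, w3. rewrite lincomb_coord. apply mk21_eq.
    repeat split; apply (Rmult_eq_reg_l a); try exact h; field_simplify; lra.
  - exists w1, w3. rewrite lincomb_coord. apply mk21_eq.
    repeat split; apply (Rmult_eq_reg_l b); try exact h; field_simplify; lra.
  - exists w1, w2. rewrite lincomb_coord. apply mk21_eq.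
    repeat split; apply (Rmult_eq_reg_l c); try exact h; field_simplify; lra.
Qed.

Lemma timelike_not_spacelike (P : R21 -> Prop) (v : R21) :
  P v -> minkowski v v < 0 -> ~ spacelike P.
Proof.
  intros hv hneg hP.
  assert (v <> zero).
  { intros ->. unfold minkowski, zero in hneg; simpl in hneg.
    unfold zero in hneg; simpl in hneg. lra. }
  specialize (hP v hv H). lra.
Qed.

(** * Tangent vectors in coordinates and their inner products with the normal *)

Definition smooth_tangent (tau : R) (z p : C) : R21 :=
  let w := (RtoC tau / (RtoC 2 * p))%C in
  Re3 (w * (RtoC 1 + z * z))%C (w * (Ci * (RtoC 1 - z * z)))%C
      (w * (- (RtoC 2 * z)))%C.

Definition edge_tangent (sigma : R) (z z1 : C) : R21 :=
  let w := (RtoC sigma / (RtoC 2 * (z1 - z)))%C in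
  Re3 (w * (RtoC 1 + z * z1))%C (w * (Ci * (RtoC 1 - z * z1)))%C
      (w * (- (z + z1)))%C.

(** Writing [1/p] as the conjugate of [p] over [|p|^2] pulls out a real factor and leaves a
    polynomial vector. *)
Lemma smooth_tangent_coord (tau a b p1 p2 : R) :
  p1 * p1 + p2 * p2 <> 0 ->
  smooth_tangent tau (a, b) (p1, p2) =
  scal (tau / (2 * (p1 * p1 + p2 * p2)))
    (mk21 (p1 * (1 + a * a - b * b) + p2 * (2 * a * b))
          (p1 * (2 * a * b) + p2 * (1 - a * a + b * b))
          (- 2 * (p1 * a + p2 * b))).
Proof.
  intros h.
  rewrite scal_coord. apply mk21_eq.
  repeat split; unfold Re; simpl; field; repeat split; try exact h; nra.
Qed.

Lemma edge_tangent_coord (sigma a b d1 d2 : R) :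
  d1 * d1 + d2 * d2 <> 0 ->
  edge_tangent sigma (a, b) (a + d1, b + d2) =
  scal (sigma / (2 * (d1 * d1 + d2 * d2)))
    (mk21
      (d1 * (1 + a * (a + d1) - b * (b + d2)) + d2 * (a * (b + d2) + b * (a + d1)))
      (d1 * (a * (b + d2) + b * (a + d1)) + d2 * (1 - a * (a + d1) + b * (b + d2)))
      (- (d1 * (2 * a + d1) + d2 * (2 * b + d2)))).
Proof.
  intros h.
  rewrite scal_coord. apply mk21_eq.
  repeat split; unfold Re; simpl; field; repeat split; try exact h; nra.
Qed.

(** Quotient rule: [s] is half the derivative of [|g|^2], so [m] has derivative [-2 s]. *)
Lemma dV_normal (g : Z -> R -> C) (k : Z) (t : R) :
  differentiableC (g k) t -> Cmod (g k t) ^ 2 <> 1 ->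
  let a := fst (g k t) in let b := snd (g k t) in
  let p1 := fst (dC (g k) t) in let p2 := snd (dC (g k) t) in
  let m := 1 - (a * a + b * b) in
  let s := a * p1 + b * p2 in
  dV (normal g k) t =
  mk21 ((- 2 * p1 * m - 4 * a * s) / m ^ 2) ((- 2 * p2 * m - 4 * b * s) / m ^ 2)
       (4 * s / m ^ 2).
Proof.
  intros [ha hb] h1 a b p1 p2 m s.
  rewrite Cmod_sqr in h1. fold a b in h1.
  assert (hm : m <> 0) by (unfold m; lra).
  set (A := fun u => Re (g k u)) in *. set (B := fun u => Im (g k u)) in *.
  assert (hA : A t = a) by reflexivity. assert (hB : B t = b) by reflexivity.
  unfold dV.
  rewrite (Derive_ext _
    (fun u => / (1 - (A u * A u + B u * B u)) * (- 2 * A u)));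
    [|intros u; unfold normal; rewrite Cmod_sqr; reflexivity].
  rewrite (Derive_ext (fun u => snd (fst _))
    (fun u => / (1 - (A u * A u + B u * B u)) * (- 2 * B u)));
    [|intros u; unfold normal; rewrite Cmod_sqr; reflexivity].
  rewrite (Derive_ext (fun u => snd _)
    (fun u => / (1 - (A u * A u + B u * B u)) * (1 + (A u * A u + B u * B u))));
    [|intros u; unfold normal; rewrite Cmod_sqr; reflexivity].
  change p1 with (Derive A t) in *. change p2 with (Derive B t) in *.
  unfold s, m, p1, p2 in *.
  apply mk21_eq; repeat split; apply is_derive_unique; auto_derive;
    rewrite ?hA, ?hB; try (repeat split; assumption || lra);
    change (Derive (fun u => A u) t) with (Derive A t);
    change (Derive (fun u => B u) t) with (Derive B t);
    field; lra.
Qed.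

(** Here [dx = - tau dn / <dn, dn>], with [<dn, dn> = 4 |dg|^2 / (1 - |g|^2)^2]. *)
Lemma minkowski_dV_normal (g : Z -> R -> C) (tau : R) (k : Z) (t : R) :
  differentiableC (g k) t -> dC (g k) t <> RtoC 0 -> Cmod (g k t) ^ 2 <> 1 ->
  minkowski (dV (normal g k) t) (smooth_tangent tau (g k t) (dC (g k) t))
  = - tau.
Proof.
  intros hd hp h1. rewrite (dV_normal g k t hd h1).
  rewrite Cmod_sqr in h1. apply norm2_neq_0 in hp.
  destruct (g k t) as [a b], (dC (g k) t) as [p1 p2]; simpl in *.
  rewrite smooth_tangent_coord, scal_coord by exact hp.
  unfold minkowski; simpl. field. split; [exact hp | lra].
Qed.

(** The complex vector [(1 + z^2, i (1 - z^2), -2 z)] is null for the bilinear form, so the real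
    part of its multiple by [w] has squared length [|w|^2 (1 - |z|^2)^2]. *)
Lemma smooth_tangent_not_timelike (tau : R) (z p : C) :
  p <> RtoC 0 ->
  0 <= minkowski (smooth_tangent tau z p) (smooth_tangent tau z p).
Proof.
  intros hp. apply norm2_neq_0 in hp.
  destruct z as [a b], p as [p1 p2]; simpl in *.
  rewrite smooth_tangent_coord, scal_coord by exact hp.
  unfold minkowski; simpl.
  set (c := tau / (2 * (p1 * p1 + p2 * p2))).
  match goal with |- 0 <= ?e =>
    replace e with ((c * (1 - a * a - b * b)) ^ 2 * (p1 * p1 + p2 * p2)) by ring
  end.
  apply Rmult_le_pos; [apply pow2_ge_0 | nra].
Qed.

(** The discrete analogue: [Delta x = - sigma Delta n / <Delta n, Delta n>]. Now
    [<Delta n, Delta n>] is [4 |Delta g|^2] over [(1 - |g|^2) (1 - |g_1|^2)], which can be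
    negative. *)
Lemma minkowski_Delta_normal (g : Z -> R -> C) (sigma : R) (k : Z) (t : R) :
  DeltaC g k t <> RtoC 0 ->
  Cmod (g k t) ^ 2 <> 1 -> Cmod (g (k + 1)%Z t) ^ 2 <> 1 ->
  minkowski (DeltaV (normal g) k t)
    (edge_tangent sigma (g k t) (g (k + 1)%Z t)) = - sigma.
Proof.
  unfold DeltaV, DeltaC, normal. rewrite !Cmod_sqr.
  destruct (g k t) as [a b], (g (k + 1)%Z t) as [a1 b1]; simpl.
  intros hd h h1. apply norm2_neq_0 in hd; simpl in hd.
  replace a1 with (a + (a1 + - a)) in * by ring.
  replace b1 with (b + (b1 + - b)) in * by ring.
  set (d1 := a1 + - a) in *. set (d2 := b1 + - b) in *.
  replace (a + d1 + - a) with d1 in hd by ring.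
  replace (b + d2 + - b) with d2 in hd by ring.
  rewrite edge_tangent_coord, !scal_coord by exact hd.
  unfold minkowski, minus, plus, opp; simpl.
  unfold plus, opp; simpl.
  field. repeat split; lra.
Qed.

(** The circle through [z] and [z1] that is tangent to [p] at [z] is mapped by
    [normal] into an affine plane whose direction is the kernel of
    [(N1, N2, N3)] below.  Since
    [p * q / (z1 - z)^2] is real, this circle is also tangent to [q] at [z1]. *)
Lemma edge_coplanar (lam sigma : R) (z z1 p q : C) :
  lam <> 0 -> p <> RtoC 0 -> (z1 - z)%C <> RtoC 0 -> Cmod z ^ 2 <> 1 ->
  (p * q / ((z1 - z) * (z1 - z)))%C = RtoC lam ->
  exists P : R21 -> Prop, is_plane P /\
    P (smooth_tangent (lam * sigma) z p) /\
    P (smooth_tangent (lam * sigma) z1 q) /\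
    P (edge_tangent sigma z z1).
Proof.
  intros hl hp hd h1 hq.
  (* The cross-ratio condition gives [q = lam (z1 - z)^2 / p]; substituting it eliminates both [q]
     and [lam] from the tangent vector at [z1]. *)
  assert (hw : (RtoC (lam * sigma) / (RtoC 2 * q)
    = RtoC sigma * p / (RtoC 2 * ((z1 - z) * (z1 - z))))%C).
  { assert (hl' : RtoC lam <> RtoC 0) by (intros e; apply hl, RtoC_inj, e).
    assert (h2 : RtoC 2 <> RtoC 0) by (intros e; apply RtoC_inj in e; lra).
    assert (e : (q = RtoC lam * ((z1 - z) * (z1 - z)) / p)%C)
      by (rewrite <- hq; field; auto).
    rewrite e, RtoC_mult. field. repeat split; assumption. }
  assert (ht1 : smooth_tangent (lam * sigma) z1 q =
    let w := (RtoC sigma * p / (RtoC 2 * ((z1 - z) * (z1 - z))))%C in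
    Re3 (w * (RtoC 1 + z1 * z1))%C (w * (Ci * (RtoC 1 - z1 * z1)))%C
        (w * (- (RtoC 2 * z1)))%C)
    by (unfold smooth_tangent; rewrite hw; reflexivity).
  rewrite ht1. clear hq hw ht1 q.
  rewrite Cmod_sqr in h1. apply norm2_neq_0 in hp. apply norm2_neq_0 in hd.
  destruct z as [a b], z1 as [a1 b1], p as [p1 p2]; simpl in hp, hd, h1.
  replace a1 with (a + (a1 + - a)) in * by ring.
  replace b1 with (b + (b1 + - b)) in * by ring.
  set (d1 := a1 + - a) in *. set (d2 := b1 + - b) in *.
  replace (a + d1 + - a) with d1 in hd by ring.
  replace (b + d2 + - b) with d2 in hd by ring.
  clearbody d1 d2. clear a1 b1.
  (* With [d = z1 - z], the circle is [al |u - z|^2 = n (p2 (u1 - a) - p1 (u2 - b))], a line if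
     [al = 0]. Expanded, it reads [al |u|^2 + b1 u1 + b2 u2 + c = 0]. Then
     [(N1, N2, N3) = (- b1, - b2, al + c)], and the linear form with these coefficients takes the
     constant value [al - c] on the normals over the circle. *)
  set (n := d1 * d1 + d2 * d2) in *.
  set (al := p2 * d1 - p1 * d2).
  set (N1 := - (- p2 * n - 2 * al * a)).
  set (N2 := - (p1 * n - 2 * al * b)).
  set (N3 := al + (al * (a * a + b * b) - (- p2 * n * a + p1 * n * b))).
  exists (fun w => N1 * fst (fst w) + N2 * snd (fst w) + N3 * snd w = 0).
  split; [|split; [|split]].
  - apply kernel_is_plane. intros (e1 & e2 & e3).
    (* As [|z|] is not 1, this forces [al = 0]; then [N1 = p2 n] and [N2 = - p1 n], so [p] would
       vanish. *)
    assert (hal : al * (1 - (a * a + b * b)) = 0).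
    { replace (al * (1 - (a * a + b * b))) with (N3 - (N1 * a + N2 * b))
        by (unfold N1, N2, N3; ring).
      rewrite e1, e2, e3. ring. }
    assert (al0 : al = 0)
      by (destruct (Rmult_integral _ _ hal); [assumption | lra]).
    unfold N1 in e1; unfold N2 in e2; rewrite al0 in e1, e2.
    assert (p2 = 0) by (apply (Rmult_eq_reg_r n); [lra | exact hd]).
    assert (p1 = 0) by (apply (Rmult_eq_reg_r n); [lra | exact hd]).
    subst p1 p2. apply hp; ring.
  - rewrite smooth_tangent_coord, scal_coord by exact hp.
    simpl. unfold N1, N2, N3, al, n. field. exact hp.
  - simpl. unfold N1, N2, N3, al, n. unfold Re; simpl. field.
    (* The denominator is the squared modulus of [2 (z1 - z)^2]. *)
    match goal with |- ?e <> 0 => replace e with (4 * (n * n)) end.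
    + repeat apply Rmult_integral_contrapositive_currified; lra.
    + unfold n. ring.
  - rewrite edge_tangent_coord, scal_coord by exact hd.
    simpl. unfold N1, N2, N3, al, n. field. exact hd.
Qed.

(** * Curvature signs and singular edges of a given surface *)

Section SemiDiscreteMaximal.

Variables (D : Z -> R -> Prop) (g : Z -> R -> C) (tau : R -> R)
  (sigma : Z -> R) (x : Z -> R -> R21).
Hypotheses (hg : sd_holomorphic D g tau sigma)
  (hx : sd_maximal D g tau sigma x).

(** [smooth_tangent] and [edge_tangent] repeat the formulas of [sd_maximal], so these equations hold
    by conversion. *)
Lemma dV_eq (k : Z) (t : R) :
  D k t -> dV (x k) t = smooth_tangent (tau t) (g k t) (dC (g k) t).
Proof. intros h. apply (proj1 hx k t h). Qed.

Lemma DeltaV_eq (k : Z) (t : R) :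
  D k t -> D (k + 1)%Z t ->
  DeltaV x k t = edge_tangent (sigma k) (g k t) (g (k + 1)%Z t).
Proof. intros h h1. apply (proj2 hx k t h h1). Qed.

Lemma tau_sigma_lt_0 (k : Z) (t : R) :
  D k t -> D (k + 1)%Z t -> tau t * sigma k < 0.
Proof.
  intros h h1. destruct (proj2 hg k t h h1) as (_ & hs & _ & hneg).
  replace (tau t * sigma k) with (tau t / sigma k * (sigma k * sigma k))
    by (field; exact hs).
  assert (0 < sigma k * sigma k) by nra. nra.
Qed.

Lemma curv_mult (k : Z) (t kappa : R) :
  D k t -> is_curv g tau x k t kappa ->
  kappa * minkowski (dV (x k) t) (dV (x k) t) = tau t.
Proof.
  intros h [hfin e]. destruct (proj1 hg k t h) as [hd hp].
  (* Finite curvature keeps [g] off the unit circle, where [normal] would divide by zero. *)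
  assert (h1 : Cmod (g k t) ^ 2 <> 1).
  { intros h1. apply hfin. unfold curv_infinite, curv_den. rewrite h1. ring. }
  apply Ropp_eq_reg. rewrite <- (minkowski_dV_normal g (tau t) k t hd hp h1).
  rewrite <- dV_eq, e, minkowski_scal_l by exact h. ring.
Qed.

Lemma edge_curv_mult (k : Z) (t kappa : R) :
  D k t -> D (k + 1)%Z t -> is_edge_curv g sigma x k t kappa ->
  kappa * minkowski (DeltaV x k t) (DeltaV x k t) = sigma k.
Proof.
  intros h hk [hfin e]. destruct (proj2 hg k t h hk) as [hd _].
  unfold edge_curv_infinite, edge_curv_den in hfin.
  assert (h1 : Cmod (g k t) ^ 2 <> 1)
    by (intros h1; apply hfin; rewrite h1; ring).
  assert (h2 : Cmod (g (k + 1)%Z t) ^ 2 <> 1)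
    by (intros h2; apply hfin; rewrite h2; ring).
  apply Ropp_eq_reg.
  rewrite <- (minkowski_Delta_normal g (sigma k) k t hd h1 h2).
  rewrite <- DeltaV_eq, e, minkowski_scal_l by assumption. ring.
Qed.

(** The timelike [Delta x] excludes every spacelike candidate. Finiteness of the curvature serves
    the existence of a tangent plane, through [|g| <> 1]. *)
Lemma timelike_edge_singular (k : Z) (t : R) :
  D k t -> D (k + 1)%Z t -> ~ edge_curv_infinite g sigma k t ->
  minkowski (DeltaV x k t) (DeltaV x k t) < 0 -> edge_singular x k t.
Proof.
  intros h hk hfin hneg. split.
  - destruct (proj2 hg k t h hk) as (hd & hs & hq & hlam).
    destruct (proj1 hg k t h) as [_ hp].
    assert (h1 : Cmod (g k t) ^ 2 <> 1).
    { intros h1. apply hfin. unfold edge_curv_infinite, edge_curv_den.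
      rewrite h1. ring. }
    destruct (edge_coplanar (tau t / sigma k) (sigma k) (g k t)
      (g (k + 1)%Z t) (dC (g k) t) (dC (g (k + 1)%Z) t))
      as (P & hP & P1 & P2 & P3); try assumption; [lra |].
    replace (tau t / sigma k * sigma k) with (tau t) in P1, P2
      by (field; exact hs).
    exists P. unfold is_tangent_plane.
    rewrite !dV_eq, DeltaV_eq by assumption. auto.
  - intros P (_ & _ & _ & hP). exact (timelike_not_spacelike P _ hP hneg).
Qed.

(** Both curvatures are taken at the same [t], so their product times a nonnegative number equals
    [tau t] squared. *)
Lemma no_curv_sign_change (k : Z) (t : R) :
  D k t -> D (k + 1)%Z t -> ~ curv_sign_change g tau x k t.
Proof.
  intros h hk (ka & kb & ha & hb & hneg).
  apply curv_mult in ha; [| exact h]. apply curv_mult in hb; [| exact hk].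
  assert (na : 0 <= minkowski (dV (x k) t) (dV (x k) t)).
  { rewrite dV_eq by exact h.
    apply smooth_tangent_not_timelike, (proj1 hg k t h). }
  assert (nb : 0 <= minkowski (dV (x (k + 1)%Z) t) (dV (x (k + 1)%Z) t)).
  { rewrite dV_eq by exact hk.
    apply smooth_tangent_not_timelike, (proj1 hg _ t hk). }
  (* The edge condition supplies [tau t <> 0], so that the square is positive. *)
  pose proof (tau_sigma_lt_0 k t h hk).
  set (A := minkowski _ _) in ha, na. set (B := minkowski _ _) in hb, nb.
  assert (ka * kb * (A * B) = tau t * tau t)
    by (rewrite <- ha at 1; rewrite <- hb; ring).
  assert (0 <= A * B) by nra.
  assert (tau t <> 0) by nra.
  assert (0 < tau t * tau t) by nra.
  nra.
Qed.

End SemiDiscreteMaximal.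

Theorem theorem5p3 (D : Z -> R -> Prop) (g : Z -> R -> C)
    (tau : R -> R) (sigma : Z -> R) (x : Z -> R -> R21)
    (hD : is_subdomain D)
    (hg : sd_holomorphic D g tau sigma)
    (hx : sd_maximal D g tau sigma x) :
  (forall (k : Z) (t : R),
     D (k - 1)%Z t -> D k t -> D (k + 1)%Z t ->
     singular_discrete g sigma x k t ->
     ~ edge_curv_infinite g sigma (k - 1)%Z t ->
     ~ edge_curv_infinite g sigma k t ->
     edge_singular x (k - 1)%Z t \/ edge_singular x k t)
  /\
  (forall (k : Z) (t : R),
     D (k - 1)%Z t -> D k t -> D (k + 1)%Z t ->
     singular_smooth g tau x k t ->
     ~ curv_sign_change g tau x (k - 1)%Z t /\
     ~ curv_sign_change g tau x k t /\
     (exists j : Z, (j = k - 1 \/ j = k \/ j = k + 1)%Z /\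
        curv_infinite g tau j t) /\
     (forall j : Z, (j = k - 1 \/ j = k \/ j = k + 1)%Z ->
        curv_infinite g tau j t -> Cmod (g j t) = 1)).
Proof.
  split; intros k t h0 h h1 hsing.
  - intros hf0 hf.
    destruct hsing as [(ka & kb & ha & hb & hneg) | [hi | hi]];
      [| contradiction | contradiction].
    (* The right end of edge [k - 1] appears as [k - 1 + 1], which is not syntactically [k]. *)
    assert (h' : D (k - 1 + 1)%Z t) by now rewrite Z.sub_add.
    apply (edge_curv_mult D g tau sigma x hg hx) in ha; try assumption.
    apply (edge_curv_mult D g tau sigma x hg hx) in hb; try assumption.
    pose proof (tau_sigma_lt_0 D g tau sigma hg _ t h0 h') as s0.
    pose proof (tau_sigma_lt_0 D g tau sigma hg _ t h h1) as s1.
    destruct (Rlt_le_dec (minkowski (DeltaV x (k - 1) t) (DeltaV x (k - 1) t)) 0)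
      as [n0 | p0].
    { left. exact (timelike_edge_singular D g tau sigma x hg hx _ t h0 h' hf0 n0). }
    destruct (Rlt_le_dec (minkowski (DeltaV x k t) (DeltaV x k t)) 0) as [n1 | p1].
    { right. exact (timelike_edge_singular D g tau sigma x hg hx _ t h h1 hf n1). }
    (* If neither edge is timelike, the curvature product times [A * B >= 0] is
       [sigma (k - 1) * sigma k], which is positive because both factors have the sign opposite to
       [tau t]. *)
    exfalso.
    set (A := minkowski _ _) in ha, p0. set (B := minkowski _ _) in hb, p1.
    assert (ka * kb * (A * B) = sigma (k - 1)%Z * sigma k)
      by (rewrite <- ha, <- hb; ring).
    assert (0 <= A * B) by nra.
    assert (0 < sigma (k - 1)%Z * sigma k) by nra.
    nra.
  - assert (n0 : ~ curv_sign_change g tau x (k - 1)%Z t).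
    { apply (no_curv_sign_change D g tau sigma x hg hx); [exact h0 |].
      now rewrite Z.sub_add. }
    pose proof (no_curv_sign_change D g tau sigma x hg hx k t h h1) as n1.
    split; [exact n0 | split; [exact n1 | split]].
    + destruct hsing as [s | [s | [s | [s | s]]]];
        [contradiction | contradiction | exists (k - 1)%Z | exists k
        | exists (k + 1)%Z]; (split; [lia | exact s]).
    + intros j _ hj. unfold curv_infinite, curv_den in hj.
      (* Since [tau t <> 0], the curvature denominator can vanish only through [1 - |g|^2]. *)
      pose proof (tau_sigma_lt_0 D g tau sigma hg _ t h h1).
      pose proof (Cmod_ge_0 (g j t)).
      apply Rmult_integral in hj. destruct hj as [hj | hj]; [nra |].
      assert (1 - Cmod (g j t) ^ 2 = 0) by nra.
      nra.
Qed.
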